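(* Let $X=(X_1, X_2\rightrightarrows\mathcal C_{X_1})$ be generating data and let $C$ be a set of conditions on $X$. There exists a unique (up to isomorphism) 2-category $\mathcal A_{X,C}$ equipped with a map $G:\mathcal F_X\to\mathcal A_{X,C}$ in $p_2Cat$ such that $G(x)=G(y)$ whenever $xCy$ and such that $\mathcal A_{X,C}$ is universal with respect to this property in the following sense: given a 2-category $D$ and a map $F:\mathcal F_X\to D$ in $p_2Cat$ such that for all $x,y\in\mathcal F_X$, $xCy$ implies $F(x)=F(y)$, there is a unique map of 2-categories $H:\mathcal A_{X,C}\to D$ such that $HG=F$ in $p_2Cat$.
   Context: Everything is small. For $n\ge 0$, an *$n$-categorically graded set* is a set $S$ with maps $s_i,t_i : S \to S$ for $0\le i<n$ such that, whenever $\sigma_i,\rho_i \in \{s_i,t_i\}$: (i) $\rho_i\sigma_i = \sigma_i$ for all $i$; (ii) for all $i<j$ and $\sigma_i\in\{s_i,t_i\}$, $\rho_j\in\{s_j,t_j\}$, $\rho_j\sigma_i=\sigma_i$ and $\sigma_i\rho_j=\sigma_i$. Morphisms are functions preserving all $s_i,t_i$; this gives the category $gr_nCat$. The set of $i$-morphisms of $\mathcal A$ is $\mathcal A_i:=s_i\mathcal A=t_i\mathcal A$ (a $k$-morphism is identified with the identity $(k+1)$-morphism on it). A *pre-$n$-category* is an $n$-categorically graded set $\mathcal A$ together with compositions $*_i : \{(a,b)\in\mathcal A\times\mathcal A : s_i a = t_i b\}\to\mathcal A$ for $0\le i\le n-1$ such that $s_i(a*_i b)=s_i b$, $t_i(a*_i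 b)=t_i a$, and for $i<j$ and $\rho_j\in\{s_j,t_j\}$, $\rho_j(a*_i b)=\rho_j a *_i \rho_j b$. (No associativity, unit or interchange laws are required.) Morphisms are functions preserving all $s_i,t_i,*_i$; this gives the category $p_nCat$. A *2-category* here means a bicategory: a pre-2-category $\mathcal A$ with 2-isomorphisms $\alpha_{h,g,f}:(h*_0g)*_0f\Rightarrow h*_0(g*_0f)$ for all composable $f,g,h\in\mathcal A_1$, $\lambda_f:t_0f*_0f\Rightarrow f$ and $\rho_f:f*_0s_0f\Rightarrow f$ for all $f\in\mathcal A_1$, satisfying the usual bicategory axioms (coherence conditions): $*_1$ is strictly associative and unital ($a*_1s_1a=a=t_1a*_1a$), the interchange law between $*_0$ and $*_1$, naturality of $\alpha,\lambda,\rho$, and the pentagon and triangle identities. A *map of 2-categories* is a morphism of pre-2-categories (so strictly preserving sources, targets and both compositions) which preserves the $\alpha$'s, $\lambda$'s and $\rho$'s. *Free pre-1-category.* For $X_1\in gr_1Cat$, $\mathcal C_{X_1}\in p_1Cat$ is the pre-1-category of fully parenthesized composable formal words in $X_1$: $S_1=X_1$, $S_n=\bigsqcup_{1\le p\le n-1}\{x\bullet_0 y : x\in S_p,\ y\in S_{n-p},\ s_0x=t_0y\}$, $\mathcal C_{X_1}=\bigsqcup_{n\ge1}S_n$, with $s_0(x\bullet_0y)=s_0y$, $t_0(x\bullet_0y)=t_0x$ and $x*_0y=x\bullet_0y$. *Generating data* $X=(X_1,X_2\rightrightarrows\mathcal C_{X_1})$ consists of $X_1\in gr_1Cat$ and a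 set $X_2$ with maps of sets $s_1,t_1:X_2\to\mathcal C_{X_1}$ such that $\sigma_0s_1=\sigma_0t_1$ for $\sigma_0\in\{s_0,t_0\}$. Write $\mathcal C=\mathcal C_{X_1}$. The disjoint union $X_2\cup\mathcal C$ is a 2-categorically graded set with $s_1=t_1=\mathrm{id}$ on $\mathcal C$ and $\sigma_0:=\sigma_0s_1$ on $X_2$. *The pre-2-category $\mathcal F_X$ generated by $X$* is $\bigsqcup_{n\ge1}T_n$, where $T_1=X_2\sqcup\mathcal C$, $T_2$ is the set of formal words $x\bullet_iy$ with $i\in\{0,1\}$, $x,y\in T_1$, $s_ix=t_iy$, excluding words $x\bullet_0y$ with $x,y\in\mathcal C$, and for $n>2$, $T_n=\bigsqcup_{0<p<n}\{x\bullet_iy: i\in\{0,1\}, x\in T_p,y\in T_{n-p},s_ix=t_iy\}$. Its structure is $s_i(x\bullet_iy)=s_iy$, $t_i(x\bullet_iy)=t_ix$, $s_0(x\bullet_1y)=s_0y$, $t_0(x\bullet_1y)=t_0x$, $\sigma_1(x\bullet_0y)=\sigma_1x*_0\sigma_1y$ for $\sigma_1\in\{s_1,t_1\}$; $x*_1y=x\bullet_1y$; and $x*_0y$ is the composite in $\mathcal C$ if $x,y\in\mathcal C$, and $x\bullet_0y$ otherwise. A *set of conditions* on $X$ is a binary relation $C$ on (the underlying set of) $\mathcal F_X$. *)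

(* Defs.v *)
From mathcomp Require Import all_boot.
From Stdlib Require Import ProofIrrelevance.

Set Implicit Arguments.
Unset Strict Implicit.
Unset Printing Implicit Defensive.

Inductive side := source | target.

(* [bd source i] and [bd target i] are the maps s_i and t_i; quantifying over a
   [side] expresses "for sigma_i in {s_i, t_i}". *)
Record gradedSet (n : nat) := GradedSet {
  carrier :> Type;
  bd : side -> 'I_n -> carrier -> carrier;
  bd_idem : forall (e e' : side) (i : 'I_n) (x : carrier),
    bd e i (bd e' i x) = bd e' i x;
  bd_hi_lo : forall (e e' : side) (i j : 'I_n) (x : carrier),
    i < j -> bd e j (bd e' i x) = bd e' i x;
  bd_lo_hi : forall (e e' : side) (i j : 'I_n) (x : carrier),
    i < j -> bd e i (bd e' j x) = bd e i x
}.

Arguments bd {n g} e i x.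

Notation src := (bd source).
Notation tgt := (bd target).

Definition is_graded_map n (S T : gradedSet n) (f : S -> T) : Prop :=
  forall (e : side) (i : 'I_n) (x : S), f (bd e i x) = bd e i (f x).

(* The set of i-morphisms, as the image of s_i. *)
Definition is_mor n (S : gradedSet n) (i : 'I_n) (a : S) : Prop :=
  exists b : S, src i b = a.

Definition composable n (S : gradedSet n) (i : 'I_n) (a b : S) : Prop :=
  src i a = tgt i b.

Lemma composable_bd n (S : gradedSet n) (e : side) (i j : 'I_n) (a b : S) :
  i < j -> composable i a b -> composable i (bd e j a) (bd e j b).
Proof. by move=> ij ab; rewrite /composable !bd_lo_hi. Qed.

Lemma composable_map n (S T : gradedSet n) (f : S -> T) (i : 'I_n) (a b : S) :
  is_graded_map f -> composable i a b -> composable i (f a) (f b).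
Proof. by move=> hf ab; rewrite /composable -!hf ab. Qed.

(* [compose i] is a function on the set of pairs (a, b) with s_i a = t_i b; its
   dependence on the composability proof is immaterial by proof irrelevance. *)
Record preCat (n : nat) := PreCat {
  preCat_graded :> gradedSet n;
  compose : forall (i : 'I_n) (a b : preCat_graded),
    composable i a b -> preCat_graded;
  src_compose : forall (i : 'I_n) (a b : preCat_graded) (ab : composable i a b),
    src i (compose ab) = src i b;
  tgt_compose : forall (i : 'I_n) (a b : preCat_graded) (ab : composable i a b),
    tgt i (compose ab) = tgt i a;
  bd_compose : forall (e : side) (i j : 'I_n) (a b : preCat_graded)
      (ij : i < j) (ab : composable i a b),
    bd e j (compose ab) = compose (composable_bd e ij ab)
}.

Arguments compose {n p} i a b _.

Record is_preCat_map n (A B : preCat n) (f : A -> B) : Prop := IsPreCatMap {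
  preCat_map_graded : is_graded_map f;
  preCat_map_compose : forall (i : 'I_n) (a b : A) (ab : composable i a b),
    f (compose i a b ab)
      = compose i (f a) (f b) (composable_map preCat_map_graded ab)
}.

Notation i0 := (@ord0 1).
Notation i1 := (@ord_max 1).

Section PreTwoCat.
Variable A : preCat 2.
Implicit Types (a b f g : A) (e : side).

Lemma compose_eq i a b a' b' (p : composable i a b) (p' : composable i a' b') :
  a = a' -> b = b' -> compose i a b p = compose i a' b' p'.
Proof.
by move=> ea eb; subst a' b'; rewrite (proof_irrelevance _ p p').
Qed.

Lemma bd11 e e' a : bd e i1 (bd e' i1 a) = bd e' i1 a.
Proof. exact: bd_idem. Qed.
Lemma bd00 e e' a : bd e i0 (bd e' i0 a) = bd e' i0 a.
Proof. exact: bd_idem. Qed.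
Lemma bd10 e e' a : bd e i1 (bd e' i0 a) = bd e' i0 a.
Proof. exact: bd_hi_lo. Qed.
Lemma bd01 e e' a : bd e i0 (bd e' i1 a) = bd e i0 a.
Proof. exact: bd_lo_hi. Qed.

Lemma vcomp_bd0 e a b : composable i1 a b -> bd e i0 a = bd e i0 b.
Proof. by move=> ab; rewrite -(bd01 e source a) ab bd01. Qed.

Lemma bd1_mor e f : is_mor i1 f -> bd e i1 f = f.
Proof. by case=> b <-; rewrite bd11. Qed.

Lemma src0_compose1 a b (p : composable i1 a b) :
  src i0 (compose i1 a b p) = src i0 b.
Proof. by rewrite -(bd01 source source) src_compose bd01. Qed.
Lemma tgt0_compose1 a b (p : composable i1 a b) :
  tgt i0 (compose i1 a b p) = tgt i0 a.
Proof. by rewrite -(bd01 target target) tgt_compose bd01. Qed.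

Lemma bd1_compose0 e a b (p : composable i0 a b) :
  bd e i1 (compose i0 a b p)
    = compose i0 (bd e i1 a) (bd e i1 b) (@composable_bd _ _ e i0 i1 a b isT p).
Proof. exact: bd_compose. Qed.

Lemma is_mor_bd1 e a : is_mor i1 (bd e i1 a).
Proof. by exists (bd e i1 a); rewrite bd11. Qed.
Lemma is_mor_bd0 e a : is_mor i1 (bd e i0 a).
Proof. by exists (bd e i0 a); rewrite bd10. Qed.
Lemma is_mor_compose0 f g (p : composable i0 f g) :
  is_mor i1 f -> is_mor i1 g -> is_mor i1 (compose i0 f g p).
Proof.
move=> hf hg; exists (compose i0 f g p).
by rewrite bd1_compose0; apply: compose_eq; apply: bd1_mor.
Qed.

End PreTwoCat.

Lemma is_mor_map n (S T : gradedSet n) (F : S -> T) (i : 'I_n) (f : S) :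
  is_graded_map F -> is_mor i f -> is_mor i (F f).
Proof. by move=> hF [b <-]; exists (F b); rewrite hF. Qed.

(* Discharges the composability and "is a 1-morphism" side conditions, so that
   the bicategory laws below can be written as they are on paper. *)
Ltac face_simpl :=
  repeat first
    [ progress rewrite ?bd11 ?bd00 ?bd10 ?bd01 ?src_compose ?tgt_compose
        ?src0_compose1 ?tgt0_compose1 ?bd1_compose0
    | match goal with
      | H : is_mor i1 ?f |- context [bd ?e i1 ?f] => rewrite (@bd1_mor _ e f H)
      end ].

Ltac face_eq :=
  first
    [ assumption | reflexivity | congruence
    | apply: compose_eq; face_simpl; face_eq ].

Ltac globular_facts :=
  repeat match goal with
    | H : composable i1 ?a ?b |- _ =>
        pose proof (vcomp_bd0 source H); pose proof (vcomp_bd0 target H);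
        unfold composable in H
    end.

Ltac side_condition :=
  solve
    [ assumption
    | repeat match goal with
        | |- is_mor _ (bd _ i1 _) => apply: is_mor_bd1
        | |- is_mor _ (bd _ i0 _) => apply: is_mor_bd0
        | |- is_mor _ (compose _ _ _ _) => apply: is_mor_compose0
        | |- is_mor _ _ => assumption
        end
    | globular_facts; unfold composable in *; face_simpl; face_eq ].

Notation "a \o0 b" := (compose i0 a b ltac:(side_condition))
  (at level 40, left associativity, only parsing).
Notation "a \o1 b" := (compose i1 a b ltac:(side_condition))
  (at level 50, left associativity, only parsing).

Definition is_2iso (A : preCat 2) (a : A) : Prop :=
  exists (b : A) (ab : composable i1 a b) (ba : composable i1 b a),
    compose i1 a b ab = tgt i1 a /\ compose i1 b a ba = src i1 a.

Definition is_2iso_between (A : preCat 2) (a f g : A) : Prop :=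
  [/\ src i1 a = f, tgt i1 a = g & is_2iso a].

Record constraintData := ConstraintData {
  cd_preCat :> preCat 2;
  alpha : forall h g f : cd_preCat, is_mor i1 h -> is_mor i1 g -> is_mor i1 f ->
    composable i0 h g -> composable i0 g f -> cd_preCat;
  lambda : forall f : cd_preCat, is_mor i1 f -> cd_preCat;
  rho : forall f : cd_preCat, is_mor i1 f -> cd_preCat;
  alpha_2iso : forall (h g f : cd_preCat)
      (mh : is_mor i1 h) (mg : is_mor i1 g) (mf : is_mor i1 f)
      (hg : composable i0 h g) (gf : composable i0 g f),
    is_2iso_between (alpha mh mg mf hg gf)
      ((h \o0 g) \o0 f) (h \o0 (g \o0 f));
  lambda_2iso : forall (f : cd_preCat) (mf : is_mor i1 f),
    is_2iso_between (lambda mf) (tgt i0 f \o0 f) f;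
  rho_2iso : forall (f : cd_preCat) (mf : is_mor i1 f),
    is_2iso_between (rho mf) (f \o0 src i0 f) f
}.

Arguments alpha {c} h g f _ _ _ _ _.
Arguments lambda {c} f _.
Arguments rho {c} f _.

Notation "'α[' h , g , f ]" :=
  (alpha h g f ltac:(side_condition) ltac:(side_condition)
     ltac:(side_condition) ltac:(side_condition) ltac:(side_condition))
  (at level 0, h, g, f at level 200, only parsing).
Notation "'λ[' f ]" := (lambda f ltac:(side_condition))
  (at level 0, f at level 200, only parsing).
Notation "'ρ[' f ]" := (rho f ltac:(side_condition))
  (at level 0, f at level 200, only parsing).

Section ConstraintFaces.
Variable A : constraintData.
Implicit Types (f g h : A) (e : side).

Lemma src1_alpha h g f mh mg mf hg gf :
  src i1 (@alpha A h g f mh mg mf hg gf) = (h \o0 g) \o0 f.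
Proof.
by have [-> _ _] := alpha_2iso mh mg mf hg gf; do 2!apply: compose_eq => //.
Qed.
Lemma tgt1_alpha h g f mh mg mf hg gf :
  tgt i1 (@alpha A h g f mh mg mf hg gf) = h \o0 (g \o0 f).
Proof.
by have [_ -> _] := alpha_2iso mh mg mf hg gf; do 2!apply: compose_eq => //.
Qed.
Lemma src0_alpha h g f mh mg mf hg gf :
  src i0 (@alpha A h g f mh mg mf hg gf) = src i0 f.
Proof. by rewrite -(bd01 source source) src1_alpha src_compose. Qed.
Lemma tgt0_alpha h g f mh mg mf hg gf :
  tgt i0 (@alpha A h g f mh mg mf hg gf) = tgt i0 h.
Proof. by rewrite -(bd01 target source) src1_alpha !tgt_compose. Qed.

Lemma src1_lambda f mf : src i1 (@lambda A f mf) = tgt i0 f \o0 f.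
Proof. by have [-> _ _] := lambda_2iso mf; apply: compose_eq. Qed.
Lemma tgt1_lambda f mf : tgt i1 (@lambda A f mf) = f.
Proof. by have [_ -> _] := lambda_2iso mf. Qed.
Lemma bd0_lambda e f mf : bd e i0 (@lambda A f mf) = bd e i0 f.
Proof. by rewrite -(bd01 e target) tgt1_lambda. Qed.

Lemma src1_rho f mf : src i1 (@rho A f mf) = f \o0 src i0 f.
Proof. by have [-> _ _] := rho_2iso mf; apply: compose_eq. Qed.
Lemma tgt1_rho f mf : tgt i1 (@rho A f mf) = f.
Proof. by have [_ -> _] := rho_2iso mf. Qed.
Lemma bd0_rho e f mf : bd e i0 (@rho A f mf) = bd e i0 f.
Proof. by rewrite -(bd01 e target) tgt1_rho. Qed.

End ConstraintFaces.

Ltac face_simpl ::=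
  repeat first
    [ progress rewrite ?bd11 ?bd00 ?bd10 ?bd01 ?src_compose ?tgt_compose
        ?src0_compose1 ?tgt0_compose1 ?bd1_compose0
        ?src1_alpha ?tgt1_alpha ?src0_alpha ?tgt0_alpha
        ?src1_lambda ?tgt1_lambda ?bd0_lambda ?src1_rho ?tgt1_rho ?bd0_rho
    | match goal with
      | H : is_mor i1 ?f |- context [bd ?e i1 ?f] => rewrite (@bd1_mor _ e f H)
      end ].

Record is_bicategory (A : constraintData) : Prop := IsBicategory {
  vcomp_assoc : forall (a b c : A)
      (ab : composable i1 a b) (bc : composable i1 b c),
    (a \o1 b) \o1 c = a \o1 (b \o1 c);
  vcomp_unit_r : forall a : A, a \o1 src i1 a = a;
  vcomp_unit_l : forall a : A, tgt i1 a \o1 a = a;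
  interchange : forall (a b c d : A)
      (ab : composable i1 a b) (cd : composable i1 c d) (ac : composable i0 a c),
    (a \o1 b) \o0 (c \o1 d) = (a \o0 c) \o1 (b \o0 d);
  alpha_natural : forall (c b a : A)
      (cb : composable i0 c b) (ba : composable i0 b a),
    α[tgt i1 c, tgt i1 b, tgt i1 a] \o1 ((c \o0 b) \o0 a)
      = (c \o0 (b \o0 a)) \o1 α[src i1 c, src i1 b, src i1 a];
  lambda_natural : forall a : A,
    λ[tgt i1 a] \o1 (tgt i0 a \o0 a) = a \o1 λ[src i1 a];
  rho_natural : forall a : A,
    ρ[tgt i1 a] \o1 (a \o0 src i0 a) = a \o1 ρ[src i1 a];
  pentagon : forall (k h g f : A)
      (mk : is_mor i1 k) (mh : is_mor i1 h) (mg : is_mor i1 g)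
      (mf : is_mor i1 f) (kh : composable i0 k h) (hg : composable i0 h g)
      (gf : composable i0 g f),
    α[k, h, g \o0 f] \o1 α[k \o0 h, g, f]
      = (k \o0 α[h, g, f]) \o1 (α[k, h \o0 g, f] \o1 (α[k, h, g] \o0 f));
  triangle : forall (g f : A) (mg : is_mor i1 g) (mf : is_mor i1 f)
      (gf : composable i0 g f),
    (g \o0 λ[f]) \o1 α[g, tgt i0 f, f] = ρ[g] \o0 f
}.

Record bicategory := Bicategory {
  bicat_data :> constraintData;
  bicat_axioms : is_bicategory bicat_data
}.

Record is_bicat_map (A B : bicategory) (F : A -> B) : Prop := IsBicatMap {
  bicat_map_preCat : is_preCat_map F;
  bicat_map_alpha : forall (h g f : A)
      (mh : is_mor i1 h) (mg : is_mor i1 g) (mf : is_mor i1 f)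
      (hg : composable i0 h g) (gf : composable i0 g f),
    F (alpha h g f mh mg mf hg gf)
      = alpha (F h) (F g) (F f)
          (is_mor_map (preCat_map_graded bicat_map_preCat) mh)
          (is_mor_map (preCat_map_graded bicat_map_preCat) mg)
          (is_mor_map (preCat_map_graded bicat_map_preCat) mf)
          (composable_map (preCat_map_graded bicat_map_preCat) hg)
          (composable_map (preCat_map_graded bicat_map_preCat) gf);
  bicat_map_lambda : forall (f : A) (mf : is_mor i1 f),
    F (lambda f mf)
      = lambda (F f) (is_mor_map (preCat_map_graded bicat_map_preCat) mf);
  bicat_map_rho : forall (f : A) (mf : is_mor i1 f),
    F (rho f mf)
      = rho (F f) (is_mor_map (preCat_map_graded bicat_map_preCat) mf)
}.

Definition is_bicat_iso (A B : bicategory) (F : A -> B) : Prop :=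
  is_bicat_map F /\
  exists K : B -> A, [/\ is_bicat_map K, K \o F = id & F \o K = id].

Lemma sig_eq (T : Type) (P : T -> Prop) (u v : {x | P x}) :
  proj1_sig u = proj1_sig v -> u = v.
Proof.
case: u v => [x px] [y py] /= exy; subst y.
by rewrite (proof_irrelevance _ px py).
Qed.

Notation j0 := (@ord0 0).

Lemma ord1_eq (i : 'I_1) : i = j0.
Proof. by case: i => [[|//] lti]; apply: val_inj. Qed.

Section Free1.
Variable X1 : gradedSet 1.

(* Parenthesized words, well formed or not: composability of a word is defined
   recursively along with the word, so it is imposed afterwards by [word_wf]. *)
Inductive word :=
| letter of X1
| dot of word & word.

Fixpoint word_bd (e : side) (w : word) : X1 :=
  match w with
  | letter x => bd e j0 x
  | dot x y => match e with source => word_bd e y | target => word_bd e x end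
  end.

Fixpoint word_wf (w : word) : Prop :=
  match w with
  | letter _ => True
  | dot x y => [/\ word_wf x, word_wf y & word_bd source x = word_bd target y]
  end.

Lemma bd_word_bd e e' w : bd e j0 (word_bd e' w) = word_bd e' w.
Proof.
by elim: w => [x|x IHx y IHy] /=; [apply: bd_idem | case: e' IHx IHy].
Qed.

Definition free1_carrier := {w : word | word_wf w}.

Definition free1_bd (e : side) (i : 'I_1) (w : free1_carrier) : free1_carrier :=
  exist word_wf (letter (word_bd e (proj1_sig w))) I.

Lemma free1_bd_idem e e' i w :
  free1_bd e i (free1_bd e' i w) = free1_bd e' i w.
Proof. by apply: sig_eq; rewrite /= bd_word_bd. Qed.

Lemma free1_no_pair (i j : 'I_1) : i < j -> False.
Proof. by rewrite (ord1_eq i) (ord1_eq j). Qed.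

Definition free1_graded : gradedSet 1 :=
  @GradedSet 1 free1_carrier free1_bd free1_bd_idem
    (fun _ _ i j _ ij => match free1_no_pair ij with end)
    (fun _ _ i j _ ij => match free1_no_pair ij with end).

Lemma free1_compose_wf (i : 'I_1) (x y : free1_graded) :
  composable i x y -> word_wf (dot (proj1_sig x) (proj1_sig y)).
Proof. by case: x y => [x wx] [y wy] [] /= xy; split. Qed.

Definition free1_compose (i : 'I_1) (x y : free1_graded)
    (xy : composable i x y) : free1_graded :=
  exist word_wf (dot (proj1_sig x) (proj1_sig y)) (free1_compose_wf xy).

Definition free1 : preCat 1 :=
  @PreCat 1 free1_graded free1_compose
    (fun _ _ _ _ => erefl) (fun _ _ _ _ => erefl)
    (fun _ i j _ _ ij _ => match free1_no_pair ij with end).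

End Free1.

Arguments letter {X1} x.
Arguments dot {X1} x y.

Record genData := GenData {
  gen1 : gradedSet 1;
  gen2 : Type;
  gen2_bd : side -> gen2 -> free1 gen1;
  gen2_globular : forall (e : side) (x : gen2),
    bd e j0 (gen2_bd source x) = bd e j0 (gen2_bd target x)
}.

Section Free2.
Variable X : genData.

(* [path] is the inclusion of the free pre-1-category (its well-formedness is
   required in [word2_wf]); [dot0] and [dot1] are the two formal compositions.
   [word2_wf] rejects a [dot0] of two paths, which are composed inside [path]
   instead, but not a [dot1] of two paths. *)
Inductive word2 :=
| cell of gen2 X
| path of word (gen1 X)
| dot0 of word2 & word2
| dot1 of word2 & word2.

Fixpoint word2_bd0 (e : side) (w : word2) : gen1 X :=
  match w with
  | cell x => word_bd e (proj1_sig (gen2_bd source x))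
  | path c => word_bd e c
  | dot0 x y | dot1 x y =>
      match e with source => word2_bd0 e y | target => word2_bd0 e x end
  end.

Fixpoint word2_bd1 (e : side) (w : word2) : word (gen1 X) :=
  match w with
  | cell x => proj1_sig (gen2_bd e x)
  | path c => c
  | dot0 x y => dot (word2_bd1 e x) (word2_bd1 e y)
  | dot1 x y =>
      match e with source => word2_bd1 e y | target => word2_bd1 e x end
  end.

Definition is_path (w : word2) : bool := if w is path _ then true else false.

Fixpoint word2_wf (w : word2) : Prop :=
  match w with
  | cell _ => True
  | path c => word_wf c
  | dot0 x y => [/\ word2_wf x, word2_wf y,
      word2_bd0 source x = word2_bd0 target y & ~ (is_path x /\ is_path y)]
  | dot1 x y => [/\ word2_wf x, word2_wf y &
      word2_bd1 source x = word2_bd1 target y]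
  end.

Lemma word_bd_bd1 e w : word2_wf w ->
  forall e', word_bd e (word2_bd1 e' w) = word2_bd0 e w.
Proof.
elim: w => [x _|c _|x IHx y IHy [wx wy _ _]|x IHx y IHy [wx wy xy]] e' //=.
- have [] := gen2_globular e x; by case: e'.
- by case: e IHx IHy => [_ -> //|-> //].
- move: (IHx wx) (IHy wy) => {}IHx {}IHy; case: e' e IHx IHy => -[] IHx IHy //.
  + by rewrite -(IHx source) xy IHy.
  + by rewrite -(IHy target) -xy IHx.
Qed.

Lemma word2_bd1_wf e w : word2_wf w -> word_wf (word2_bd1 e w).
Proof.
elim: w => [x _|c //|x IHx y IHy [wx wy xy _]|x IHx y IHy [wx wy _]] /=.
- exact: proj2_sig.
- by split; [exact: IHx | exact: IHy | rewrite !word_bd_bd1].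
- by case: e IHx IHy => IHx IHy; [exact: IHy | exact: IHx].
Qed.

Lemma bd_word2_bd0 e e' w : bd e j0 (word2_bd0 e' w) = word2_bd0 e' w.
Proof.
by elim: w => [x|c|x IHx y IHy|x IHx y IHy] /=;
  rewrite ?bd_word_bd //; case: e' IHx IHy.
Qed.

Definition free2_carrier := {w : word2 | word2_wf w}.

Definition free2_path (c : free1 (gen1 X)) : free2_carrier :=
  exist word2_wf (path (proj1_sig c)) (proj2_sig c).

Definition free2_bd (e : side) (i : 'I_2) (w : free2_carrier) : free2_carrier :=
  if val i is 0 then
    exist word2_wf (path (letter (word2_bd0 e (proj1_sig w)))) I
  else
    exist word2_wf (path (word2_bd1 e (proj1_sig w)))
      (word2_bd1_wf e (proj2_sig w)).

Lemma ord2_case (P : 'I_2 -> Prop) : P i0 -> P i1 -> forall i, P i.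
Proof.
move=> P0 P1 [[|[|//]] lti].
- by rewrite (_ : Ordinal lti = i0) //; apply: val_inj.
- by rewrite (_ : Ordinal lti = i1) //; apply: val_inj.
Qed.

Lemma free2_bd_idem e e' i w :
  free2_bd e i (free2_bd e' i w) = free2_bd e' i w.
Proof.
by elim/ord2_case: i; apply: sig_eq; rewrite /= ?bd_word2_bd0.
Qed.

Lemma free2_bd_hi_lo e e' (i j : 'I_2) w :
  i < j -> free2_bd e j (free2_bd e' i w) = free2_bd e' i w.
Proof. by elim/ord2_case: i; elim/ord2_case: j => // _; apply: sig_eq. Qed.

Lemma free2_bd_lo_hi e e' (i j : 'I_2) w :
  i < j -> free2_bd e i (free2_bd e' j w) = free2_bd e i w.
Proof.
elim/ord2_case: i; elim/ord2_case: j => // _; apply: sig_eq => /=.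
by rewrite word_bd_bd1 //; apply: proj2_sig.
Qed.

Definition free2_graded : gradedSet 2 :=
  GradedSet free2_bd_idem free2_bd_hi_lo free2_bd_lo_hi.

Definition word2_comp0 (x y : word2) : word2 :=
  match x, y with
  | path c, path d => path (dot c d)
  | _, _ => dot0 x y
  end.

Definition word2_comp (i : 'I_2) (x y : word2) : word2 :=
  if val i is 0 then word2_comp0 x y else dot1 x y.

Lemma word2_comp_wf (i : 'I_2) (x y : free2_graded) :
  composable i x y -> word2_wf (word2_comp i (proj1_sig x) (proj1_sig y)).
Proof.
elim/ord2_case: i; case: x y => [x wx] [y wy] [] /= xy; last by split.
by case: x y wx wy xy => [?|?|? ?|? ?] [?|?|? ?|? ?] wx wy xy /=; split => //=;
  case.
Qed.

Definition free2_compose (i : 'I_2) (x y : free2_graded)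
    (xy : composable i x y) : free2_graded :=
  exist word2_wf (word2_comp i (proj1_sig x) (proj1_sig y)) (word2_comp_wf xy).

Lemma word2_bd0_comp0 e x y : word2_bd0 e (word2_comp0 x y) =
  match e with source => word2_bd0 e y | target => word2_bd0 e x end.
Proof. by case: x y => [?|?|? ?|? ?] [?|?|? ?|? ?]. Qed.

Lemma word2_bd1_comp0 e x y : word2_bd1 e (word2_comp0 x y) =
  dot (word2_bd1 e x) (word2_bd1 e y).
Proof. by case: x y => [?|?|? ?|? ?] [?|?|? ?|? ?]. Qed.

Lemma free2_src_compose i (x y : free2_graded) (xy : composable i x y) :
  src i (free2_compose xy) = src i y.
Proof.
by elim/ord2_case: i xy => xy; apply: sig_eq; rewrite /= ?word2_bd0_comp0.
Qed.

Lemma free2_tgt_compose i (x y : free2_graded) (xy : composable i x y) :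
  tgt i (free2_compose xy) = tgt i x.
Proof.
by elim/ord2_case: i xy => xy; apply: sig_eq; rewrite /= ?word2_bd0_comp0.
Qed.

Lemma free2_bd_compose e (i j : 'I_2) (x y : free2_graded)
    (ij : i < j) (xy : composable i x y) :
  bd e j (free2_compose xy) = free2_compose (composable_bd e ij xy).
Proof.
elim/ord2_case: i ij xy; elim/ord2_case: j => // ij xy.
by apply: sig_eq; rewrite /= word2_bd1_comp0.
Qed.

Definition free2 : preCat 2 :=
  PreCat free2_src_compose free2_tgt_compose free2_bd_compose.

End Free2.

Definition respects (X : genData) (C : free2 X -> free2 X -> Prop) (T : Type)
    (F : free2 X -> T) : Prop :=
  forall x y : free2 X, C x y -> F x = F y.

Definition is_universal (X : genData) (C : free2 X -> free2 X -> Prop)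
    (A : bicategory) (G : free2 X -> A) : Prop :=
  [/\ is_preCat_map G,
      respects C G &
      forall (D : bicategory) (F : free2 X -> D),
        is_preCat_map F -> respects C F ->
        exists! H : A -> D, is_bicat_map H /\ H \o G = F].

(* Main.v *)
Require Import Defs.
From mathcomp Require Import all_boot.
From Stdlib Require Import ProofIrrelevance ClassicalEpsilon.
From Stdlib Require Import FunctionalExtensionality.

Set Implicit Arguments.
Unset Strict Implicit.
Unset Printing Implicit Defensive.

(** Bicategories are the models of an essentially algebraic theory, and
    [universal_bicat] is its free model on the generators [free2 X] subject to
    [C].  The conditions may identify 1-morphisms, even 0-morphisms, so they can
    make pairs composable that were not composable before.  Which expressions
    make sense therefore depends on which equations hold, and the free model
    cannot be obtained by adjoining constraint cells to [free2 X] and then taking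
    a quotient: the quotient creates new composites.

    The way around is semantic.  A model is a bicategory [D] with a map
    [free2 X -> D] in pre-2-categories respecting [C].  Formal expressions in
    the generators ([term]) are built with no well-formedness condition, and
    each has at most one value in each model ([denotes_functional]).  The
    elements of the universal bicategory are the families of elements, one in
    each model, that are named by a single term having a value in every model.
    They form a sub-bicategory of the product of all models: every operation is
    pointwise and is again named by a term, and every axiom is an equation that
    holds in each model ([jointly_injective_bicategory]).  The product itself is
    too large, but a definable family is recovered from the set of its names,
    and sets of terms live in the universe of the generators ([dfam]).

    The map to a given [D] reads off the component at [D].  Any two maps of
    bicategories out of the definable families that agree on the generators are
    equal, by induction on a name ([dfam_map_ext]): a subterm of a term with a
    value everywhere has a value everywhere, hence names a definable family
    itself.  Uniqueness up to isomorphism is the usual argument on universal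
    properties. *)

(** * Maps of constraint data *)

(** The clauses hold for every choice of proofs of the side conditions on the
    image, unlike those of [is_bicat_map], which fix these proofs; and the
    notion makes sense before the axioms of a bicategory have been verified on
    [A]. *)
Record is_constraint_map (A B : constraintData) (F : A -> B) : Prop :=
  IsConstraintMap {
  cmap_bd : is_graded_map F;
  cmap_compose : forall i (a b : A) (ab : composable i a b)
      (Fab : composable i (F a) (F b)),
    F (compose i a b ab) = compose i (F a) (F b) Fab;
  cmap_alpha : forall (h g f : A) mh mg mf hg gf mFh mFg mFf Fhg Fgf,
    F (alpha h g f mh mg mf hg gf)
      = alpha (F h) (F g) (F f) mFh mFg mFf Fhg Fgf;
  cmap_lambda : forall (f : A) mf mFf, F (lambda f mf) = lambda (F f) mFf;
  cmap_rho : forall (f : A) mf mFf, F (rho f mf) = rho (F f) mFf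
}.

Lemma bicat_mapE (A B : bicategory) (F : A -> B) :
  is_bicat_map F <-> is_constraint_map F.
Proof.
split=> [[[gF cF] aF lF rF] | [gF cF aF lF rF]].
- split=> //.
  + by move=> i a b ab Fab; rewrite cF; apply: compose_eq.
  + move=> h g f *; rewrite aF /=; congr alpha; exact: proof_irrelevance.
  + move=> f *; rewrite lF /=; congr lambda; exact: proof_irrelevance.
  + move=> f *; rewrite rF /=; congr rho; exact: proof_irrelevance.
- have pF : is_preCat_map F by exists gF => i a b ab; apply: cF.
  by exists pF => *; [apply: aF | apply: lF | apply: rF].
Qed.

(** The images below are taken up to equations [F a = a'] on the arguments.
    Rewriting inside [compose] or [alpha] would be blocked by the proofs that
    depend on the arguments; chaining these lemmas avoids it. *)
Section ConstraintMapImages.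
Variables (A B : constraintData) (F : A -> B) (cF : is_constraint_map F).

Lemma image_bd e i a a' : F a = a' -> F (bd e i a) = bd e i a'.
Proof. by move=> <-; apply: cmap_bd. Qed.

Lemma image_compose i a b p a' b' q :
  F a = a' -> F b = b' -> F (compose i a b p) = compose i a' b' q.
Proof. by move=> ea eb; subst a' b'; apply: cmap_compose. Qed.

Lemma image_alpha h g f mh mg mf hg gf h' g' f' mh' mg' mf' hg' gf' :
  F h = h' -> F g = g' -> F f = f' ->
  F (alpha h g f mh mg mf hg gf) = alpha h' g' f' mh' mg' mf' hg' gf'.
Proof. by move=> eh eg ef; subst h' g' f'; apply: cmap_alpha. Qed.

Lemma image_lambda f mf f' mf' :
  F f = f' -> F (lambda f mf) = lambda f' mf'.
Proof. by move=> ef; subst f'; apply: cmap_lambda. Qed.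

Lemma image_rho f mf f' mf' : F f = f' -> F (rho f mf) = rho f' mf'.
Proof. by move=> ef; subst f'; apply: cmap_rho. Qed.

Lemma image_composable i a b :
  composable i a b -> composable i (F a) (F b).
Proof. exact: composable_map (cmap_bd cF). Qed.

Lemma image_mor i a : is_mor i a -> is_mor i (F a).
Proof. exact: is_mor_map (cmap_bd cF). Qed.

End ConstraintMapImages.

Ltac push_image cF :=
  repeat first
    [ reflexivity
    | apply: (image_compose cF) | apply: (image_bd cF)
    | apply: (image_alpha cF) | apply: (image_lambda cF)
    | apply: (image_rho cF) ].

Lemma constraint_map_id (A : constraintData) : is_constraint_map (@id A).
Proof.
split=> //= *; [exact: compose_eq|congr alpha|congr lambda|congr rho];
  exact: proof_irrelevance.
Qed.

Lemma constraint_map_comp (A B D : constraintData) (K : B -> D) (F : A -> B) :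
  is_constraint_map K -> is_constraint_map F -> is_constraint_map (K \o F).
Proof.
move=> cK cF; split=> /=.
- by move=> e i x /=; rewrite (cmap_bd cF) (cmap_bd cK).
- move=> i a b ab Fab; rewrite (cmap_compose cF ab (image_composable cF ab)).
  exact: cmap_compose.
- move=> h g f mh mg mf hg gf *.
  rewrite (cmap_alpha cF mh mg mf hg gf (image_mor cF mh) (image_mor cF mg)
    (image_mor cF mf) (image_composable cF hg) (image_composable cF gf)).
  exact: cmap_alpha.
- move=> f mf *; rewrite (cmap_lambda cF mf (image_mor cF mf)).
  exact: cmap_lambda.
- move=> f mf *; rewrite (cmap_rho cF mf (image_mor cF mf)).
  exact: cmap_rho.
Qed.

(* The goal [F l = F r] is reduced to the instance [law : l' = r'] on images. *)
Ltac pointwise cF law :=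
  refine (eq_trans _ (eq_trans law _)); [| symmetry]; push_image cF.

(** All the axioms of a bicategory are equations between operations, so they are
    reflected by a family of maps that together separate elements. *)
Lemma jointly_injective_bicategory (A : constraintData) (M : Type)
    (D : M -> bicategory) (F : forall m, A -> D m) :
  (forall m, is_constraint_map (F m)) ->
  (forall a b, (forall m, F m a = F m b) -> a = b) ->
  is_bicategory A.
Proof.
move=> cF injF.
have laws m := bicat_axioms (D m).
have comp m := image_composable (cF m).
have mor m := image_mor (cF m).
split.
- move=> a b c ab bc; apply: injF => m.
  pointwise (cF m) (vcomp_assoc (laws m) (comp m _ _ _ ab) (comp m _ _ _ bc)).
- move=> a; apply: injF => m.
  pointwise (cF m) (vcomp_unit_r (laws m) (F m a)).
- move=> a; apply: injF => m.
  pointwise (cF m) (vcomp_unit_l (laws m) (F m a)).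
- move=> a b c d ab cd ac; apply: injF => m.
  pointwise (cF m) (Defs.interchange (laws m)
    (comp m _ _ _ ab) (comp m _ _ _ cd) (comp m _ _ _ ac)).
- move=> c b a cb ba; apply: injF => m.
  pointwise (cF m)
    (alpha_natural (laws m) (comp m _ _ _ cb) (comp m _ _ _ ba)).
- move=> a; apply: injF => m.
  pointwise (cF m) (lambda_natural (laws m) (F m a)).
- move=> a; apply: injF => m.
  pointwise (cF m) (rho_natural (laws m) (F m a)).
- move=> k h g f mk mh mg mf kh hg gf; apply: injF => m.
  pointwise (cF m) (pentagon (laws m) (mor m _ _ mk) (mor m _ _ mh)
    (mor m _ _ mg) (mor m _ _ mf) (comp m _ _ _ kh) (comp m _ _ _ hg)
    (comp m _ _ _ gf)).
- move=> g f mg mf gf; apply: injF => m.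
  pointwise (cF m) (triangle (laws m) (mor m _ _ mg) (mor m _ _ mf)
    (comp m _ _ _ gf)).
Qed.

(** * Vertical inverses *)

Definition is_vinverse (A : preCat 2) (a b : A) : Prop :=
  exists (ab : composable i1 a b) (ba : composable i1 b a),
    compose i1 a b ab = tgt i1 a /\ compose i1 b a ba = src i1 a.

Lemma vinverse_unique (A : bicategory) (a b b' : A) :
  is_vinverse a b -> is_vinverse a b' -> b = b'.
Proof.
move=> [ab [ba [abE baE]]] [ab' [ba' [ab'E ba'E]]].
have laws := bicat_axioms A.
have := vcomp_assoc laws ba ab'.
have ->: forall p, compose i1 (compose i1 b a ba) b' p = b'.
  move=> p; rewrite -[RHS](vcomp_unit_l laws); apply: compose_eq => //.
  by rewrite baE; exact: ab'.
move=> ->; rewrite -[LHS](vcomp_unit_r laws); apply: compose_eq => //.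
by rewrite ab'E; exact: ba.
Qed.

Lemma image_vinverse (A B : constraintData) (F : A -> B) (a b : A) :
  is_constraint_map F -> is_vinverse a b -> is_vinverse (F a) (F b).
Proof.
move=> cF [ab [ba [abE baE]]].
exists (image_composable cF ab), (image_composable cF ba).
by rewrite -!(cmap_compose cF) abE baE !(cmap_bd cF).
Qed.

(** * The bicategory of definable families *)

(** [Inv] stands for the inverse of any invertible 2-morphism.  Without it the
    inverses of the constraint cells would not be named by a term, and the
    constraint cells would not be invertible among the definable families. *)
Inductive term (T : Type) : Type :=
| Gen of T
| Bd of side & 'I_2 & term T
| Comp of 'I_2 & term T & term T
| Alpha of term T & term T & term T
| Lambda of term T
| Rho of term T
| Inv of term T.

(** The partial evaluation of terms, as a relation: a term has a value when its
    subterms do and these values satisfy the side conditions of its head. *)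
Fixpoint denotes (T : Type) (D : constraintData) (F : T -> D) (t : term T) :
    D -> Prop :=
  match t with
  | Gen x => fun d => d = F x
  | Bd e i t => fun d => exists2 a, denotes F t a & d = bd e i a
  | Comp i t u => fun d =>
      exists2 a, denotes F t a & exists2 b, denotes F u b &
      exists ab : composable i a b, d = compose i a b ab
  | Alpha t u v => fun d =>
      exists2 h, denotes F t h & exists2 g, denotes F u g &
      exists2 f, denotes F v f &
      exists mh mg mf hg gf, d = alpha h g f mh mg mf hg gf
  | Lambda t => fun d => exists2 f, denotes F t f & exists mf, d = lambda f mf
  | Rho t => fun d => exists2 f, denotes F t f & exists mf, d = rho f mf
  | Inv t => fun d => exists2 a, denotes F t a & is_vinverse a d
  end.

Lemma denotes_functional T (D : bicategory) (F : T -> D) t d d' :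
  denotes F t d -> denotes F t d' -> d = d'.
Proof.
elim: t d d' => [x|e i t IH|i t IHt u IHu|t IHt u IHu v IHv|t IH|t IH|t IH]
  d d' /=.
- by move=> -> ->.
- by move=> [a ta ->] [b tb ->]; rewrite (IH a b).
- move=> [a ta [b ub [ab ->]]] [a' ta' [b' ub' [ab' ->]]].
  by apply: compose_eq; [apply: IHt | apply: IHu].
- move=> [h th [g ug [f vf [mh [mg [mf [hg [gf ->]]]]]]]].
  move=> [h' th' [g' ug' [f' vf' [mh' [mg' [mf' [hg' [gf' ->]]]]]]]].
  apply: (image_alpha (constraint_map_id D)).
  + exact: IHt th th'.
  + exact: IHu ug ug'.
  + exact: IHv vf vf'.
- move=> [f tf [mf ->]] [f' tf' [mf' ->]].
  by apply: (image_lambda (constraint_map_id D)); apply: IH tf tf'.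
- move=> [f tf [mf ->]] [f' tf' [mf' ->]].
  by apply: (image_rho (constraint_map_id D)); apply: IH tf tf'.
- move=> [a ta ad] [a' ta' ad'].
  by rewrite -(IH _ _ ta ta') in ad'; apply: vinverse_unique ad ad'.
Qed.

Section DefinableFamilies.
Variables (T M : Type) (D : M -> bicategory) (F : forall m, T -> D m).

Definition family := forall m, D m.

Definition names (t : term T) (v : family) : Prop :=
  forall m, denotes (F m) t (v m).

Definition definable (v : family) : Prop := exists t, names t v.

(** A definable family is represented by the set of its names, so that [dfam]
    lives in the universe of [T] rather than in that of [M]; this matters when
    [M] is a type of all models, among which the bicategory on [dfam] must
    itself be counted. *)
Definition dfam : Type :=
  {P : term T -> Prop |
    exists v : family, definable v /\ P = fun t => names t v}.

Definition dfam_of (v : family) (dv : definable v) : dfam :=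
  exist _ (fun t => names t v) (ex_intro _ v (conj dv erefl)).

Definition at_ (a : dfam) : family :=
  proj1_sig (constructive_indefinite_description _ (proj2_sig a)).

Lemma at_spec a : definable (at_ a) /\ proj1_sig a = fun t => names t (at_ a).
Proof.
exact: proj2_sig (constructive_indefinite_description _ (proj2_sig a)).
Qed.

Lemma at_inj a b : (forall m, at_ a m = at_ b m) -> a = b.
Proof.
move=> ab; apply: sig_eq; have [_ ->] := at_spec a; have [_ ->] := at_spec b.
by rewrite (functional_extensionality_dep _ _ ab).
Qed.

Lemma at_of v (dv : definable v) m : at_ (dfam_of dv) m = v m.
Proof.
have [_ /= e] := at_spec (dfam_of dv).
have [t tv] := dv.
have : names t (at_ (dfam_of dv)).
  by rewrite -[names t _]/((fun u => names u _) t) -e.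
by move=> /(_ m) td; apply: denotes_functional td (tv m).
Qed.

Lemma dfam_of_at a v (dv : definable v) :
  (forall m, at_ a m = v m) -> a = dfam_of dv.
Proof. by move=> av; apply: at_inj => m; rewrite av at_of. Qed.

(** A term with a value in every model, each satisfying [P], names one
    definable family.  This is how values chosen model by model, such as those
    of a subterm or the inverses of the components of a family, are
    assembled. *)
Lemma dfam_choice t (P : forall m, D m -> Prop) :
  (forall m, exists2 d, denotes (F m) t d & P m d) ->
  exists2 a, names t (at_ a) & forall m, P m (at_ a m).
Proof.
move=> exP.
have {}exP m : exists d, denotes (F m) t d /\ P m d.
  by have [d td Pd] := exP m; exists d.
pose v m := proj1_sig (constructive_indefinite_description _ (exP m)).
have vP m : denotes (F m) t (v m) /\ P m (v m).
  exact: proj2_sig (constructive_indefinite_description _ (exP m)).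
have dv : definable v by exists t => m; case: (vP m).
by exists (dfam_of dv) => m; rewrite at_of; case: (vP m).
Qed.

Lemma bd_definable e i a : definable (fun m => bd e i (at_ a m)).
Proof.
by have [[t ta] _] := at_spec a; exists (Bd e i t) => m; exists (at_ a m).
Qed.

Definition dfam_bd e i a : dfam := dfam_of (bd_definable e i a).

Lemma at_dfam_bd e i a m : at_ (dfam_bd e i a) m = bd e i (at_ a m).
Proof. exact: at_of. Qed.

Lemma dfam_bd_idem e e' i a : dfam_bd e i (dfam_bd e' i a) = dfam_bd e' i a.
Proof. by apply: at_inj => m; rewrite !at_dfam_bd bd_idem. Qed.

Lemma dfam_bd_hi_lo e e' (i j : 'I_2) a :
  i < j -> dfam_bd e j (dfam_bd e' i a) = dfam_bd e' i a.
Proof. by move=> ij; apply: at_inj => m; rewrite !at_dfam_bd bd_hi_lo. Qed.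

Lemma dfam_bd_lo_hi e e' (i j : 'I_2) a :
  i < j -> dfam_bd e i (dfam_bd e' j a) = dfam_bd e i a.
Proof. by move=> ij; apply: at_inj => m; rewrite !at_dfam_bd bd_lo_hi. Qed.

Definition dfam_graded : gradedSet 2 :=
  GradedSet dfam_bd_idem dfam_bd_hi_lo dfam_bd_lo_hi.

Lemma at_bd (e : side) (i : 'I_2) (a : dfam_graded) m :
  at_ (bd e i a) m = bd e i (at_ a m).
Proof. exact: at_dfam_bd. Qed.

Lemma composable_at (i : 'I_2) (a b : dfam_graded) m :
  composable i a b -> composable i (at_ a m) (at_ b m).
Proof. by move=> ab; rewrite /composable -!at_bd ab. Qed.

Lemma composable_of_at (i : 'I_2) (a b : dfam_graded) :
  (forall m, composable i (at_ a m) (at_ b m)) -> composable i a b.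
Proof. by move=> ab; apply: at_inj => m; rewrite !at_bd ab. Qed.

Lemma mor_at (i : 'I_2) (f : dfam_graded) m : is_mor i f -> is_mor i (at_ f m).
Proof. by case=> b <-; rewrite at_bd; exists (at_ b m). Qed.

Lemma mor_of_at (f : dfam_graded) :
  (forall m, is_mor i1 (at_ f m)) -> is_mor i1 f.
Proof. by move=> mf; exists f; apply: at_inj => m; rewrite at_bd bd1_mor. Qed.

Lemma compose_definable (i : 'I_2) (a b : dfam_graded) (ab : composable i a b) :
  definable (fun m => compose i (at_ a m) (at_ b m) (composable_at m ab)).
Proof.
have [[t ta] _] := at_spec a; have [[u ub] _] := at_spec b.
exists (Comp i t u) => m; exists (at_ a m) => //; exists (at_ b m) => //.
by exists (composable_at m ab).
Qed.

Definition dfam_compose (i : 'I_2) (a b : dfam_graded) (ab : composable i a b) :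
  dfam_graded := dfam_of (compose_definable ab).

Lemma at_dfam_compose i a b (ab : composable i a b) m p :
  at_ (dfam_compose ab) m = compose i (at_ a m) (at_ b m) p.
Proof. by rewrite at_of; apply: compose_eq. Qed.

Lemma dfam_src_compose i a b (ab : composable i a b) :
  src i (dfam_compose ab) = src i b.
Proof.
apply: at_inj => m; rewrite !at_bd (at_dfam_compose ab (composable_at m ab)).
exact: src_compose.
Qed.

Lemma dfam_tgt_compose i a b (ab : composable i a b) :
  tgt i (dfam_compose ab) = tgt i a.
Proof.
apply: at_inj => m; rewrite !at_bd (at_dfam_compose ab (composable_at m ab)).
exact: tgt_compose.
Qed.

Lemma dfam_bd_compose e (i j : 'I_2) a b (ij : i < j) (ab : composable i a b) :
  bd e j (dfam_compose ab) = dfam_compose (composable_bd e ij ab).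
Proof.
apply: at_inj => m; rewrite at_bd (at_dfam_compose ab (composable_at m ab)).
by rewrite bd_compose at_of; apply: compose_eq; rewrite at_bd.
Qed.

Definition dfam_preCat : preCat 2 :=
  PreCat dfam_src_compose dfam_tgt_compose dfam_bd_compose.

Lemma at_compose i (a b : dfam_preCat) (ab : composable i a b) m p :
  at_ (compose i a b ab) m = compose i (at_ a m) (at_ b m) p.
Proof. exact: at_dfam_compose. Qed.

Lemma vinverse_of_at (a b : dfam_preCat) :
  (forall m, is_vinverse (at_ a m) (at_ b m)) -> is_vinverse a b.
Proof.
move=> inv.
have ab : composable i1 a b.
  by apply: composable_of_at => m; case: (inv m).
have ba : composable i1 b a.
  by apply: composable_of_at => m; have [? []] := inv m.
exists ab, ba; split; apply: at_inj => m; have [abm [bam [abE baE]]] := inv m.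
- by rewrite (at_compose ab abm) abE at_bd.
- by rewrite (at_compose ba bam) baE at_bd.
Qed.

(** The inverses of the components form a definable family, named by [Inv]. *)
Lemma iso_of_at (a : dfam_preCat) : (forall m, is_2iso (at_ a m)) -> is_2iso a.
Proof.
move=> iso; have [[t ta] _] := at_spec a.
have [m|b _ ab] := @dfam_choice (Inv t) (fun m => is_vinverse (at_ a m)).
  by have [b ab] := iso m; exists b => //; exists (at_ a m).
by exists b; apply: vinverse_of_at.
Qed.

Lemma iso_between_of_at (a f g : dfam_preCat) :
  (forall m, is_2iso_between (at_ a m) (at_ f m) (at_ g m)) ->
  is_2iso_between a f g.
Proof.
move=> iso; split; last by apply: iso_of_at => m; have [] := iso m.
- by apply: at_inj => m; rewrite at_bd; have [] := iso m.
- by apply: at_inj => m; rewrite at_bd; have [] := iso m.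
Qed.

Section Alpha.
Variables (h g f : dfam_preCat)
  (mh : is_mor i1 h) (mg : is_mor i1 g) (mf : is_mor i1 f)
  (hg : composable i0 h g) (gf : composable i0 g f).

Lemma alpha_definable : definable (fun m =>
  alpha (at_ h m) (at_ g m) (at_ f m) (mor_at m mh) (mor_at m mg) (mor_at m mf)
    (composable_at m hg) (composable_at m gf)).
Proof.
have [[t th] _] := at_spec h; have [[u ug] _] := at_spec g.
have [[v vf] _] := at_spec f.
exists (Alpha t u v) => m /=.
exists (at_ h m) => //; exists (at_ g m) => //; exists (at_ f m) => //.
by do 5!eexists.
Qed.

Definition dfam_alpha : dfam_preCat := dfam_of alpha_definable.

Lemma dfam_alpha_2iso :
  is_2iso_between dfam_alpha ((h \o0 g) \o0 f) (h \o0 (g \o0 f)).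
Proof.
apply: iso_between_of_at => m; rewrite at_of.
have [s t iso] := alpha_2iso (mor_at m mh) (mor_at m mg) (mor_at m mf)
  (composable_at m hg) (composable_at m gf).
split=> //; [rewrite s | rewrite t].
- by rewrite at_of; apply: compose_eq => //; rewrite at_of; apply: compose_eq.
- by rewrite at_of; apply: compose_eq => //; rewrite at_of; apply: compose_eq.
Qed.

End Alpha.

Section LambdaRho.
Variables (f : dfam_preCat) (mf : is_mor i1 f).

Lemma lambda_definable : definable (fun m => lambda (at_ f m) (mor_at m mf)).
Proof.
have [[t tf] _] := at_spec f; exists (Lambda t) => m /=.
by exists (at_ f m) => //; exists (mor_at m mf).
Qed.

Lemma rho_definable : definable (fun m => rho (at_ f m) (mor_at m mf)).
Proof.
have [[t tf] _] := at_spec f; exists (Rho t) => m /=.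
by exists (at_ f m) => //; exists (mor_at m mf).
Qed.

Definition dfam_lambda : dfam_preCat := dfam_of lambda_definable.
Definition dfam_rho : dfam_preCat := dfam_of rho_definable.

Lemma dfam_lambda_2iso : is_2iso_between dfam_lambda (tgt i0 f \o0 f) f.
Proof.
apply: iso_between_of_at => m; rewrite at_of.
have [s t iso] := lambda_2iso (mor_at m mf).
by split=> //; rewrite s at_of; apply: compose_eq; rewrite ?at_bd.
Qed.

Lemma dfam_rho_2iso : is_2iso_between dfam_rho (f \o0 src i0 f) f.
Proof.
apply: iso_between_of_at => m; rewrite at_of.
have [s t iso] := rho_2iso (mor_at m mf).
by split=> //; rewrite s at_of; apply: compose_eq; rewrite ?at_bd.
Qed.

End LambdaRho.

Definition dfam_data : constraintData :=
  ConstraintData dfam_alpha_2iso dfam_lambda_2iso dfam_rho_2iso.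

Lemma at_constraint_map m : is_constraint_map (fun a : dfam_data => at_ a m).
Proof.
split.
- by move=> e i a; apply: at_bd.
- by move=> *; apply: at_compose.
- move=> *; rewrite at_of; congr alpha; exact: proof_irrelevance.
- move=> *; rewrite at_of; congr lambda; exact: proof_irrelevance.
- move=> *; rewrite at_of; congr rho; exact: proof_irrelevance.
Qed.

Definition dfam_bicat : bicategory :=
  Bicategory (jointly_injective_bicategory at_constraint_map at_inj).

Lemma gen_definable x : definable (fun m => F m x).
Proof. by exists (Gen x). Qed.

Definition dfam_gen (x : T) : dfam_bicat := dfam_of (gen_definable x).

(** Every definable family is built from generators by operations that maps of
    bicategories preserve; inverses are preserved because they are unique. *)
Lemma dfam_map_ext (B : bicategory) (H K : dfam_bicat -> B) :
  is_constraint_map H -> is_constraint_map K ->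
  (forall x, H (dfam_gen x) = K (dfam_gen x)) -> H = K.
Proof.
move=> cH cK HK; apply: functional_extensionality => a.
have choice t (P : forall m, D m -> Prop) :
    (forall m, exists2 d, denotes (F m) t d & P m d) ->
    exists2 b : dfam_bicat, names t (at_ b) & forall m, P m (at_ b m).
  exact: dfam_choice.
have [[t ta] _] := at_spec a.
elim: t a ta => [x|e i t IH|i t IHt u IHu|t IHt u IHu v IHv|t IH|t IH|t IH]
  a ta.
- have ->: a = dfam_gen x by apply: dfam_of_at.
  exact: HK.
- have [b tb ab] := choice _ _ ta.
  have ->: a = bd e i b by apply: at_inj => m; rewrite ab at_bd.
  by rewrite (cmap_bd cH) (cmap_bd cK) (IH _ tb).
- have [b tb /choice [c uc bcP]] := choice _ _ ta.
  have bc : composable i b c by apply: composable_of_at => m; case: (bcP m).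
  have ->: a = compose i b c bc.
    by apply: at_inj => m; have [bcm ->] := bcP m; rewrite (at_compose bc bcm).
  rewrite (cmap_compose cH bc (image_composable cH bc)).
  by apply/esym/(image_compose cK); rewrite ?(IHt _ tb) ?(IHu _ uc).
- have [h th /choice [g ug /choice [f vf P]]] := choice _ _ ta.
  have mh : is_mor i1 h by apply: mor_of_at => m; case: (P m).
  have mg : is_mor i1 g by apply: mor_of_at => m; have [? []] := P m.
  have mf : is_mor i1 f by apply: mor_of_at => m; have [? [? []]] := P m.
  have hg : composable i0 h g.
    by apply: composable_of_at => m; have [? [? [? []]]] := P m.
  have gf : composable i0 g f.
    by apply: composable_of_at => m; have [? [? [? [? []]]]] := P m.
  have ->: a = alpha (h : dfam_bicat) g f mh mg mf hg gf.
    apply: at_inj => m; have [mhm [mgm [mfm [hgm [gfm ->]]]]] := P m.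
    exact/esym/(image_alpha (at_constraint_map m)).
  rewrite (cmap_alpha cH mh mg mf hg gf (image_mor cH mh) (image_mor cH mg)
    (image_mor cH mf) (image_composable cH hg) (image_composable cH gf)).
  by apply/esym/(image_alpha cK); rewrite ?(IHt _ th) ?(IHu _ ug) ?(IHv _ vf).
- have [f tf P] := choice _ _ ta.
  have mf : is_mor i1 f by apply: mor_of_at => m; case: (P m).
  have ->: a = lambda (f : dfam_bicat) mf.
    apply: at_inj => m; have [mfm ->] := P m.
    exact/esym/(image_lambda (at_constraint_map m)).
  rewrite (cmap_lambda cH mf (image_mor cH mf)).
  by apply/esym/(image_lambda cK); rewrite (IH _ tf).
- have [f tf P] := choice _ _ ta.
  have mf : is_mor i1 f by apply: mor_of_at => m; case: (P m).
  have ->: a = rho (f : dfam_bicat) mf.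
    apply: at_inj => m; have [mfm ->] := P m.
    exact/esym/(image_rho (at_constraint_map m)).
  rewrite (cmap_rho cH mf (image_mor cH mf)).
  by apply/esym/(image_rho cK); rewrite (IH _ tf).
- have [b tb /vinverse_of_at ba] := choice _ _ ta.
  apply: (@vinverse_unique B (H b)); first exact: (image_vinverse cH ba).
  by rewrite (IH _ tb); exact: (image_vinverse cK ba).
Qed.

End DefinableFamilies.

(** * The universal bicategory *)

Section Universal.
Variables (X : genData) (C : free2 X -> free2 X -> Prop).

Record model := Model {
  model_bicat : bicategory;
  model_map : free2 X -> model_bicat;
  model_preCat_map : is_preCat_map model_map;
  model_respects : respects C model_map
}.

Definition universal_bicat : bicategory := dfam_bicat model_map.

Definition universal_gen : free2 X -> universal_bicat :=
  dfam_gen model_map.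

Lemma at_universal_gen x m : at_ (universal_gen x) m = model_map m x.
Proof. exact: at_of. Qed.

(** [free2 X] and the definable families have their own compositions; these
    agree because they do so in each model, where the generators are mapped by a
    map of pre-2-categories. *)
Lemma universal_gen_preCat_map : is_preCat_map universal_gen.
Proof.
have gG : is_graded_map universal_gen.
  move=> e i x; apply: at_inj => m; rewrite at_bd !at_universal_gen.
  exact: preCat_map_graded (model_preCat_map m) e i x.
exists gG => i a b ab; apply: at_inj => m.
rewrite (at_compose _ (composable_at m (composable_map gG ab))).
rewrite at_universal_gen (preCat_map_compose (model_preCat_map m)).
by apply: compose_eq; rewrite at_universal_gen.
Qed.

(** A bicategory [D] with a map from [free2 X] respecting [C] is itself a model,
    so the required map is evaluation at that model. *)
Lemma universal_bicat_universal : is_universal C universal_gen.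
Proof.
split; first exact: universal_gen_preCat_map.
- move=> x y xy; apply: at_inj => m; rewrite !at_universal_gen.
  exact: model_respects xy.
move=> D F pF rF; pose m := Model pF rF.
have cH := at_constraint_map model_map m.
exists (fun a : universal_bicat => at_ a m); split.
  split; first exact/bicat_mapE.
  by apply: functional_extensionality => x; apply: (at_universal_gen x m).
move=> K [/bicat_mapE cK KG]; apply: dfam_map_ext => // x.
rewrite -[K _]/((K \o universal_gen) x) KG; exact: (at_universal_gen x m).
Qed.

End Universal.

Lemma bicat_map_id (A : bicategory) : is_bicat_map (@id A).
Proof. exact/bicat_mapE/constraint_map_id. Qed.

Lemma bicat_map_comp (A B D : bicategory) (K : B -> D) (F : A -> B) :
  is_bicat_map K -> is_bicat_map F -> is_bicat_map (K \o F).
Proof.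
by move=> /bicat_mapE cK /bicat_mapE cF; apply/bicat_mapE/constraint_map_comp.
Qed.

Lemma universal_endo_id (X : genData) (C : free2 X -> free2 X -> Prop)
    (A : bicategory) (G : free2 X -> A) (K : A -> A) :
  is_universal C G -> is_bicat_map K -> K \o G = G -> K = id.
Proof.
move=> [pG rG uG] cK KG; have [H [_ uniqH]] := uG A G pG rG.
by rewrite -(uniqH K) // (uniqH id) //; split=> //; apply: bicat_map_id.
Qed.

Theorem theorem2p6 (X : genData) (C : free2 X -> free2 X -> Prop) :
  (exists (A : bicategory) (G : free2 X -> A), is_universal C G) /\
  (forall (A A' : bicategory) (G : free2 X -> A) (G' : free2 X -> A'),
     is_universal C G -> is_universal C G' ->
     exists H : A -> A', is_bicat_iso H /\ H \o G = G').
Proof.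
split.
  by exists (universal_bicat C), (@universal_gen X C);
    apply: universal_bicat_universal.
move=> A A' G G' uG uG'.
have [pG rG exG] := uG; have [pG' rG' exG'] := uG'.
have [H [[cH HG] _]] := exG A' G' pG' rG'.
have [K [[cK KG'] _]] := exG' A G pG rG.
exists H; split=> //; split=> //; exists K; split=> //.
- apply: (universal_endo_id uG); first exact: bicat_map_comp.
  by rewrite -[LHS]/(K \o (H \o G)) HG.
- apply: (universal_endo_id uG'); first exact: bicat_map_comp.
  by rewrite -[LHS]/(H \o (K \o G')) KG'.
Qed.
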